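(* Let $\mathbb{C}$ be a small category equipped with an independent-pullback structure, and let $P\colon\mathbb{C}^{op}\to\mathbf{Set}$ be a presheaf. Then the following are equivalent: (1) $P$ is an atomic sheaf; (2) $P$ maps every independent square to a pullback in $\mathbf{Set}$; that is, for every independent square with legs $f\colon X\to Y$, $g\colon X\to Z$ and cospan $u\colon Y\to W$, $v\colon Z\to W$ (with $u\circ f = v\circ g$), the map $P(W)\to\{(y,z)\in P(Y)\times P(Z)\mid y\cdot f = z\cdot g\}$, $w\mapsto (w\cdot u, w\cdot v)$, is a bijection.
   Context: Presheaf notation: for $f\colon Y\to X$ and $x\in P(X)$, $x\cdot f := P(f)(x)$. For $c\colon Y\to X$, $y\in P(Y)$ is $c$-invariant if $y\cdot d=y\cdot e$ whenever $d,e\colon Z\to Y$ satisfy $c\circ d = c\circ e$; $x\in P(X)$ is a $c$-descendent of $y$ if $y=x\cdot c$. $P$ is an atomic sheaf if for every $c$ every $c$-invariant element has a unique $c$-descendent. A square is a commuting diagram with apex $X$, legs $f\colon X\to Y$, $g\colon X\to Z$ and cospan $u\colon Y\to W$, $v\colon Z\to W$, $u\circ f = v\circ g$. An independent-pullback structure on $\mathbb{C}$ is a class of commuting squares, called independent, such that, calling an independent square an independent pullback if for every independent square with apex $X'$, legs $f'\colon X'\to Y$, $g'\colon X'\to Z$ over the same cospan there is a unique $p\colon X'\to X$ with $f\circ p = f'$, $g\circ p = g'$, the following hold: (IP1) for every $f\colon X\to Y$ the square with apex $X$, legs $\mathrm{id}_X$ and $f$, and cospan $f\colon X\to Y$, $\mathrm{id}_Y$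 is independent; (IP2) a square is independent iff the square obtained by swapping the roles of the two legs (and correspondingly of the two cospan maps) is independent; (IP3) if two independent squares are pasted side by side along a common edge, the composite rectangle (apex the apex of the first square, legs the composite along the top and the remaining leg) is independent; (IP4) if the composite rectangle of two pasted squares is independent and the second (right) square is an independent pullback, then the first (left) square is independent; (IP5) every cospan $Y\to W\leftarrow Z$ completes to an independent pullback. *)

(* Defs.v *)
From mathcomp Require Import all_boot.
From mathcomp Require Import classical_sets functions.

Set Implicit Arguments.
Unset Strict Implicit.
Unset Printing Implicit Defensive.

Local Open Scope classical_set_scope.

Record category := Category {
  obj :> Type;
  hom : obj -> obj -> Type;
  idm : forall X, hom X X;
  compm : forall X Y Z, hom Y Z -> hom X Y -> hom X Z;
  compmA : forall W X Y Z (h : hom Y Z) (g : hom X Y) (f : hom W X),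
    compm h (compm g f) = compm (compm h g) f;
  comp1m : forall X Y (f : hom X Y), compm (idm Y) f = f;
  compm1 : forall X Y (f : hom X Y), compm f (idm X) = f }.

Arguments hom {c} X Y.
Arguments idm {c} X.
Arguments compm {c X Y Z} g f : rename.

Declare Scope cat_scope.
Delimit Scope cat_scope with cat.
Local Open Scope cat_scope.

Notation "X ~> Y" := (hom X Y) (at level 99, Y at level 200) : cat_scope.
Notation "g ∘ f" := (compm g f) (at level 40, left associativity) : cat_scope.

Record presheaf (C : category) := Presheaf {
  psh :> C -> Type;
  restr : forall X Y : C, (Y ~> X) -> psh X -> psh Y;
  restr1 : forall (X : C) (x : psh X), restr (idm X) x = x;
  restrM : forall (X Y Z : C) (f : Y ~> X) (g : Z ~> Y) (x : psh X),
    restr (f ∘ g) x = restr g (restr f x) }.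

Arguments restr {C p X Y} f x : rename.

Notation "x ⋅ f" := (restr f x) (at level 40, left associativity) : cat_scope.

Section AtomicSheaf.
Variables (C : category) (P : presheaf C).

Definition invariant_along (X Y : C) (c : Y ~> X) (y : P Y) : Prop :=
  forall (Z : C) (d e : Z ~> Y), c ∘ d = c ∘ e -> y ⋅ d = y ⋅ e.

Definition descendent_along (X Y : C) (c : Y ~> X) (y : P Y) (x : P X) : Prop :=
  y = x ⋅ c.

Definition atomic_sheaf : Prop :=
  forall (X Y : C) (c : Y ~> X) (y : P Y),
    invariant_along c y -> exists! x : P X, descendent_along c y x.

End AtomicSheaf.

(* [S f g u v] says that S contains the square
     X --f--> Y
     |        |
     g        u
     |        |
     Z --v--> W.  *)
Definition square_class (C : category) :=
  forall X Y Z W : C, (X ~> Y) -> (X ~> Z) -> (Y ~> W) -> (Z ~> W) -> Prop.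

Definition independent_pullback (C : category) (S : square_class C)
    (X Y Z W : C) (f : X ~> Y) (g : X ~> Z) (u : Y ~> W) (v : Z ~> W) : Prop :=
  S X Y Z W f g u v /\
  forall (X' : C) (f' : X' ~> Y) (g' : X' ~> Z),
    S X' Y Z W f' g' u v ->
    exists! p : X' ~> X, f ∘ p = f' /\ g ∘ p = g'.

(* In [indep_paste] and [indep_cancel] the squares are pasted as
     X --f--> Y --f'--> Y'
     |        |         |
     g        u         u'
     |        |         |
     Z --v--> W --v'--> W'.  *)
Record indep_pullback_structure (C : category) := IndepPullbackStructure {
  indep : square_class C;
  indep_comm : forall (X Y Z W : C)
      (f : X ~> Y) (g : X ~> Z) (u : Y ~> W) (v : Z ~> W),
    indep f g u v -> u ∘ f = v ∘ g;
  indep_id : forall (X Y : C) (f : X ~> Y), indep (idm X) f f (idm Y);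
  indep_sym : forall (X Y Z W : C)
      (f : X ~> Y) (g : X ~> Z) (u : Y ~> W) (v : Z ~> W),
    indep f g u v <-> indep g f v u;
  indep_paste : forall (X Y Z W Y' W' : C)
      (f : X ~> Y) (g : X ~> Z) (u : Y ~> W) (v : Z ~> W)
      (f' : Y ~> Y') (u' : Y' ~> W') (v' : W ~> W'),
    indep f g u v -> indep f' u u' v' -> indep (f' ∘ f) g u' (v' ∘ v);
  indep_cancel : forall (X Y Z W Y' W' : C)
      (f : X ~> Y) (g : X ~> Z) (u : Y ~> W) (v : Z ~> W)
      (f' : Y ~> Y') (u' : Y' ~> W') (v' : W ~> W'),
    u ∘ f = v ∘ g -> independent_pullback indep f' u u' v' ->
    indep (f' ∘ f) g u' (v' ∘ v) -> indep f g u v;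
  indep_complete : forall (Y Z W : C) (u : Y ~> W) (v : Z ~> W),
    exists (X : C) (f : X ~> Y) (g : X ~> Z),
      independent_pullback indep f g u v }.

Definition maps_to_pullback (C : category) (P : presheaf C)
    (X Y Z W : C) (f : X ~> Y) (g : X ~> Z) (u : Y ~> W) (v : Z ~> W) : Prop :=
  set_bij [set: P W] [set yz : P Y * P Z | yz.1 ⋅ f = yz.2 ⋅ g]
    (fun w => (w ⋅ u, w ⋅ v)).

(* Main.v *)
(** From (2) to (1): if [y] is [c]-invariant, it matches itself on an independent
    completion of the cospan [(c, c)], so it descends uniquely along [c].

    From (1) to (2): restriction maps of an atomic sheaf are injective, so the
    point is that, when [y ⋅ f = z ⋅ g], the element [y] is [u]-invariant.  Let
    [u ∘ d = u ∘ e] with [d, e : T ~> Y].  Completing [(f, d)] and [(f, e)] and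
    pasting with the given square gives two independent squares over the same
    cospan [(v, u ∘ d)], hence both factor through its independent pullback.
    Completing the cospan of the two factorisations gives a map [s] into [T]
    with [y ⋅ d ⋅ s = y ⋅ e ⋅ s], since both sides are the same restriction of
    [z]; now cancel [s]. *)

Require Import Defs.
From mathcomp Require Import all_boot.
From mathcomp Require Import classical_sets functions.

Set Implicit Arguments.
Unset Strict Implicit.
Unset Printing Implicit Defensive.

Local Open Scope cat_scope.

(** An element of the form [x1 ⋅ c] is [c]-invariant, and [x1], [x2] are both descendents of it. *)
Lemma atomic_sheaf_restr_inj (C : category) (P : presheaf C) :
  atomic_sheaf P ->
  forall (X Y : C) (c : Y ~> X), injective (fun x : P X => x ⋅ c).
Proof.
move=> shP X Y c x1 x2 /= eq12.
have inv1 : invariant_along c (x1 ⋅ c).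
  by move=> Z d e cde; rewrite -!restrM cde.
have [x [_ uniq_x]] := shP _ _ _ _ inv1.
by rewrite -(uniq_x x1 erefl); apply: uniq_x; rewrite /descendent_along.
Qed.

Section IndependentPullbacks.
Variables (C : category) (I : indep_pullback_structure C) (P : presheaf C).

Lemma commuting_completion (Y Z W : C) (u : Y ~> W) (v : Z ~> W) :
  exists (X : C) (f : X ~> Y) (g : X ~> Z), u ∘ f = v ∘ g.
Proof.
have [X [f [g [ind _]]]] := indep_complete I u v.
by exists X, f, g; apply: indep_comm ind.
Qed.

Lemma indep_common_span (Y Z W : C) (u : Y ~> W) (v : Z ~> W)
    (X1 X2 : C) (f1 : X1 ~> Y) (g1 : X1 ~> Z) (f2 : X2 ~> Y) (g2 : X2 ~> Z) :
  indep I f1 g1 u v -> indep I f2 g2 u v ->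
  exists (L : C) (l1 : L ~> X1) (l2 : L ~> X2),
    f1 ∘ l1 = f2 ∘ l2 /\ g1 ∘ l1 = g2 ∘ l2.
Proof.
move=> ind1 ind2; have [K [a [b [_ univ]]]] := indep_complete I u v.
have [m1 [[am1 bm1] _]] := univ _ _ _ ind1.
have [m2 [[am2 bm2] _]] := univ _ _ _ ind2.
have [L [l1 [l2 ml]]] := commuting_completion m1 m2.
by exists L, l1, l2; rewrite -am1 -bm1 -am2 -bm2 -!compmA ml.
Qed.

Lemma indep_matching_invariant (X Y Z W : C)
    (f : X ~> Y) (g : X ~> Z) (u : Y ~> W) (v : Z ~> W) (y : P Y) (z : P Z) :
  atomic_sheaf P -> indep I f g u v -> y ⋅ f = z ⋅ g -> invariant_along u y.
Proof.
(* Transposed, the square has [f] as the edge shared with the completions below. *)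
move=> shP /indep_sym ind yz T d e ude.
have [X1 [k1 [t1 [ind1 _]]]] := indep_complete I f d.
have [X2 [k2 [t2 [ind2 _]]]] := indep_complete I f e.
have sq1 := indep_paste ind1 ind.
have sq2 := indep_paste ind2 ind; rewrite -ude in sq2.
have [L [l1 [l2 [gl tl]]]] := indep_common_span sq1 sq2.
apply: (@atomic_sheaf_restr_inj _ _ shP _ _ (t1 ∘ l1)).
(* Only the side of [e] passes to [t2 ∘ l2]; the sides then become [z ⋅ g ⋅ k1 ⋅ l1] and
   [z ⋅ g ⋅ k2 ⋅ l2]. *)
rewrite /= {2}tl !restrM -!(restrM _ _ y).
rewrite -(indep_comm ind1) -(indep_comm ind2) !restrM yz.
by rewrite -!restrM !compmA gl.
Qed.

Lemma atomic_sheaf_maps_to_pullback (X Y Z W : C)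
    (f : X ~> Y) (g : X ~> Z) (u : Y ~> W) (v : Z ~> W) :
  atomic_sheaf P -> indep I f g u v -> maps_to_pullback P f g u v.
Proof.
move=> shP ind; split.
- by move=> w _ /=; rewrite -!restrM (indep_comm ind).
- by move=> w1 w2 _ _ [eqY _]; apply: (atomic_sheaf_restr_inj shP eqY).
- move=> [y z] /= yz.
  have [w [yw _]] := shP _ _ _ _ (indep_matching_invariant shP ind yz).
  exists w => //; congr (_, _); first by rewrite yw.
  (* Along [g], both [z] and [w ⋅ v] restrict to [y ⋅ f]. *)
  apply: (@atomic_sheaf_restr_inj _ _ shP _ _ g).
  by rewrite /= -yz yw -!restrM (indep_comm ind).
Qed.

Lemma maps_to_pullback_atomic_sheaf :
  (forall (X Y Z W : C)
     (f : X ~> Y) (g : X ~> Z) (u : Y ~> W) (v : Z ~> W),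
     indep I f g u v -> maps_to_pullback P f g u v) ->
  atomic_sheaf P.
Proof.
move=> pbP X Y c y inv_y.
have [K [f [g [ind _]]]] := indep_complete I c c.
have [_ inj surj] := pbP _ _ _ _ _ _ _ _ ind.
have [x _ [xc _]] := surj (y, y) (inv_y _ _ _ (indep_comm ind)).
exists x; split; first by rewrite /descendent_along xc.
by move=> x' yx'; apply: inj; rewrite ?in_setT //= xc yx'.
Qed.

End IndependentPullbacks.

Theorem theorem6p4 (C : category) (I : indep_pullback_structure C)
    (P : presheaf C) :
  atomic_sheaf P <->
  (forall (X Y Z W : C)
     (f : hom X Y) (g : hom X Z) (u : hom Y W) (v : hom Z W),
     indep I f g u v -> maps_to_pullback P f g u v).
Proof.
split=> [shP X Y Z W f g u v|]; first exact: atomic_sheaf_maps_to_pullback.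
exact: maps_to_pullback_atomic_sheaf.
Qed.
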